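(* Let $G$ be a finitely generated group. Suppose that every finite index subgroup $H$ of $G$ satisfies $b_1(H)=b_1(G)$. If $G\in\mathcal S$, then every group $\hat G$ commensurable to $G$ has property $R_\infty$.
   Context: **Property $R_\infty$.** For an endomorphism $\varphi:\pi\to\pi$ of a group, the $\varphi$-twisted conjugacy classes are the orbits of the action of $\pi$ on itself given by $\sigma\cdot\alpha=\sigma\alpha\varphi(\sigma)^{-1}$; $R(\varphi)$ is the number of orbits. A group $\pi$ has property $R_\infty$ if $R(\varphi)=\infty$ for every $\varphi\in\mathrm{Aut}(\pi)$. **Commensurability.** Groups $G,\hat G$ are commensurable if there are finite index subgroups $H\le G$ and $\hat H\le\hat G$ with $H\cong\hat H$. **Betti number.** $b_1(\Gamma)$ is the first Betti number of $\Gamma$, i.e. the rank of the abelianization $\Gamma^{\mathrm{ab}}$. **Character sphere and $\Sigma^1$.** For a finitely generated group $G$, $S(G)$ is the set of classes $[\chi]$ of nonzero $\chi\in\mathrm{Hom}(G,\mathbb R)$, where $\chi_1\sim\chi_2$ iff $\chi_1=r\chi_2$ for some $r>0$. Let $\Gamma$ be the Cayley graph of $G$ with respect to a finite generating set (edges joining $g$ and $gs$). $\Sigma^1(G)\subset S(G)$ is the set of $[\chi]$ such that the full subgraph of $\Gamma$ on the vertices $\{g\mid\chi(g)\ge0\}$ is path connected (this does not depend on the finite generating set). $\Sigma^1(G)^c=S(G)\setminus\Sigma^1(G)$. **Open hemisphere.** A set of the form $\{[\chi]\in S(G)\mid\chi(g)>0\}$ for some $g\in G$. **Transcendental.** A class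 $[\chi]$ (or a nonzero character $\chi$) is transcendental if for all nonzero $a,b\in\mathrm{Im}(\chi)$ the ratio $a/b$ is either rational or transcendental. **Spherical polytope.** A subset $P\subset S(G)$ for which there are $v_1,\dots,v_m\in V=\mathrm{Hom}(G,\mathbb R)$ such that (i) some linear map $f:V\to\mathbb R$ has $f(v_j)>0$ for all $j$; (ii) $P=\{[v]\mid v=\sum_j a_jv_j,\ a_j\ge0,\ v\ne0\}$; (iii) $v_1,\dots,v_m$ is a minimal such set, i.e. no $v_i$ is a positive linear combination of a subset of $\{v_j: j\ne i\}$. The vertices of $P$ are $[v_1],\dots,[v_m]$. **Class $\mathcal S$.** The class of finitely generated groups $G$ such that (1) $\Sigma^1(G)^c$ is non-empty and lies inside an open hemisphere of $S(G)$; and (2) $\Sigma^1(G)^c$ has finitely many connected components, each of which is a spherical polytope with transcendental vertices. *)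

(* Defs.v *)
From HB Require Import structures.
From mathcomp Require Import all_boot all_order all_algebra.
From mathcomp Require Import all_classical all_reals.
From mathcomp Require Import ereal topology numfun normedtype.

Set Implicit Arguments.
Unset Strict Implicit.
Unset Printing Implicit Defensive.

Import Order.TTheory GRing.Theory Num.Theory.
Import numFieldNormedType.Exports.

Local Open Scope classical_set_scope.
Local Open Scope ring_scope.

(* Subgroups of a possibly infinite group are represented by sets. *)

Section Groups.
Context {G : groupType}.
Local Open Scope group_scope.

Definition is_subgroup (H : set G) : Prop := group_closed (mem H).

Definition generated (A : set G) : set G := smallest is_subgroup A.

Definition generates (s : seq G) : Prop := generated [set` s] = setT.

Definition lcoset (x : G) (H : set G) : set G := [set x * h | h in H].

Definition finite_index (H : set G) : Prop :=
  finite_set [set lcoset x H | x in setT].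

Definition derived (H : set G) : set G :=
  generated [set [~ x, y] | x in H & y in H].

Definition expgz (x : G) (k : int) : G :=
  match k with Posz n => x ^+ n | Negz n => x ^- n.+1 end.

(* The images of g_0, ..., g_(n-1) in the abelianization H / [H, H] are
   linearly independent over the integers. *)
Definition ab_independent (H : set G) (n : nat) (g : 'I_n -> G) : Prop :=
  (forall i, H (g i)) /\
  forall k : 'I_n -> int,
    derived H (\prod_(i < n) expgz (g i) (k i)) -> forall i, k i = 0%R.

(* The rank of the abelian group H / [H, H], as an extended real so that it
   also makes sense when the rank is infinite. *)
Definition betti1 (R : realType) (H : set G) : \bar R :=
  ereal_sup [set (n%:R)%:E | n in
    [set n : nat | exists g : 'I_n -> G, ab_independent H g]].

Definition twisted_class (f : G -> G) (a : G) : set G :=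
  [set s * a * (f s)^-1 | s in setT].

End Groups.

Definition finitely_generated (G : groupType) : Prop :=
  exists s : seq G, generates s.

Definition R_infty (G : groupType) : Prop :=
  forall f : {multiplicative G -> G}, bijective f ->
    infinite_set [set twisted_class f a | a in setT].

(* The isomorphism H -> H' is the restriction of f, whose values outside H
   are irrelevant. *)
Definition commensurable (G G' : groupType) : Prop :=
  exists (H : set G) (H' : set G'),
    [/\ is_subgroup H, finite_index H, is_subgroup H', finite_index H' &
      exists f : G -> G', set_bij H H' f /\
        forall x y, H x -> H y -> f (x * y)%g = (f x * f y)%g].

Section Characters.
Variables (R : realType) (G : groupType).

Definition is_character : {pred G -> R} :=
  fun chi => `[< forall x y : G, chi (x * y)%g = chi x + chi y >].

Lemma is_character_submod : submod_closed is_character.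
Proof.
split=> [|a u v /asboolP hu /asboolP hv]; apply/asboolP => x y.
  by rewrite /= addr0.
by rewrite /GRing.add /GRing.scale /= hu hv scalerDr addrACA.
Qed.

HB.instance Definition _ :=
  GRing.isSubmodClosed.Build R (G -> R) is_character is_character_submod.

(* Hom(G, R) *)
Record character := Character {
  char_fun :> G -> R;
  _ : char_fun \in is_character }.

HB.instance Definition _ := [isSub for char_fun].
HB.instance Definition _ := [Choice of character by <:].
HB.instance Definition _ := [SubChoice_isSubLmodule of character by <:].

(* Pointwise convergence; when G is finitely generated this is the usual
   topology of the finite-dimensional real vector space Hom(G, R). *)
HB.instance Definition _ := Topological.copy character
  (initial_topology (char_fun : character -> {ptws G -> R})).

Definition nonzero_character := set_type [set chi : character | chi <> 0].

Definition same_ray : rel nonzero_character := fun chi1 chi2 =>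
  `[< exists2 r : R, 0 < r & val chi1 = r *: val chi2 >].

Lemma same_ray_refl : reflexive same_ray.
Proof. by move=> x; apply/asboolP; exists 1; rewrite ?scale1r. Qed.

Lemma same_ray_sym : symmetric same_ray.
Proof.
suff h x y : same_ray x y -> same_ray y x by move=> x y; apply/idP/idP => /h.
move=> /asboolP[r r0 e]; apply/asboolP; exists r^-1; first by rewrite invr_gt0.
by rewrite e scalerA mulVf ?scale1r // gt_eqF.
Qed.

Lemma same_ray_trans : transitive same_ray.
Proof.
move=> y x z /asboolP[r r0 e] /asboolP[t t0 f]; apply/asboolP.
by exists (r * t); rewrite ?mulr_gt0 // e f scalerA.
Qed.

Canonical same_ray_equiv :=
  EquivRel same_ray same_ray_refl same_ray_sym same_ray_trans.

(* S(G), with the quotient topology *)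
Definition sphere : topologicalType :=
  quotient_topology {eq_quot same_ray}%qT.

Definition ray (chi : nonzero_character) : sphere :=
  (\pi_(quotient_topology {eq_quot same_ray}) chi)%qT.

Lemma ray_eqP (chi1 chi2 : nonzero_character) :
  ray chi1 = ray chi2 <->
  exists2 r : R, 0 < r & val chi1 = r *: val chi2.
Proof.
split=> [e|h]; first exact/asboolP/(eqmodP same_ray_equiv).
exact/(eqmodP same_ray_equiv)/asboolP.
Qed.

(* Adjacency in the Cayley graph with edges joining g and g * t, t in s. *)
Definition cayley_adj (s : seq G) : rel G :=
  fun g h => ((g^-1 * h)%g \in s) || ((h^-1 * g)%g \in s).

Definition nonneg_part_connected (s : seq G) (chi : character) : Prop :=
  forall g h : G, 0 <= chi g -> 0 <= chi h ->
    exists p : seq G,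
      [/\ path (cayley_adj s) g p, {in p, forall x, 0 <= chi x} &
          last g p = h].

Definition Sigma1_wrt (s : seq G) : set sphere :=
  [set ray chi | chi in
    [set chi : nonzero_character | nonneg_part_connected s (val chi)]].

(* Sigma1_wrt s is the same set for all finite generating sets s. *)
Definition Sigma1 : set sphere :=
  [set x | exists2 s : seq G, generates s & Sigma1_wrt s x].

Definition open_hemisphere (g : G) : set sphere :=
  [set ray chi | chi in [set chi : nonzero_character | 0 < val chi g]].

Definition transcendental_number (x : R) : Prop :=
  ~ algebraicOver (ratr : rat -> R) x.

Definition transcendental (chi : character) : Prop :=
  forall a b : R, range chi a -> range chi b -> a != 0 -> b != 0 ->
    rational (a / b) \/ transcendental_number (a / b).

Definition spherical_hull (m : nat) (v : 'I_m -> character) : set sphere :=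
  [set ray w | w in
    [set w : nonzero_character | exists2 a : 'I_m -> R,
      (forall j, 0 <= a j) & val w = \sum_(j < m) a j *: v j]].

(* P is a spherical polytope with vertices the classes of v_0, ..., v_(m-1). *)
Definition polytope_vertices (P : set sphere) (m : nat)
    (v : 'I_m -> character) : Prop :=
  [/\ exists f : {scalar character}, forall j, 0 < f (v j),
      P = spherical_hull v &
      forall (i : 'I_m) (J : {set 'I_m}) (a : 'I_m -> R),
        i \notin J -> (forall j, j \in J -> 0 < a j) ->
        v i <> \sum_(j in J) a j *: v j].

Definition transcendental_polytope (P : set sphere) : Prop :=
  exists (m : nat) (v : 'I_m -> character),
    polytope_vertices P v /\ forall j, transcendental (v j).

Definition class_S : Prop :=
  [/\ finitely_generated G,
      ~` Sigma1 !=set0 /\ exists g : G, ~` Sigma1 `<=` open_hemisphere g,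
      finite_set [set connected_component (~` Sigma1) x | x in ~` Sigma1] &
      forall x, (~` Sigma1) x ->
        transcendental_polytope (connected_component (~` Sigma1) x)].

End Characters.

(* Main.v *)
(* Let phi be an automorphism of G'. Finitely many subgroups of the finitely
   generated group G' have the index of H', so some finite index subgroup K'
   of H' is phi-invariant, and it is a copy of a finite index subgroup K of G.
   As b_1(K) = b_1(G), restriction Hom(G, R) -> Hom(K, R) is bijective, so the
   automorphism f of K induced by phi acts on Hom(G, R) by a linear map T.
   Moreover chi is in Sigma^1(G) iff its restriction is in Sigma^1(K), so T
   permutes the components of the complement of Sigma^1(G) and the finitely
   many extreme rays of these components, which are vertices of polytopes.
   Hence T^p v = r v for some p > 0, r > 0 and a transcendental v; since r is
   an algebraic unit and a ratio of values of v, it is 1. The sum of the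
   T^i v, i < p, is T-fixed, and nonzero because all these characters lie in
   an open hemisphere. A nonzero f-invariant character of K separates
   infinitely many twisted conjugacy classes. *)

Require Import Defs.
From HB Require Import structures.
From mathcomp Require Import all_boot all_order all_algebra all_field.
From mathcomp Require Import all_classical all_reals.
From mathcomp Require Import ereal topology numfun normedtype.
From mathcomp Require Import zify lra.

Set Implicit Arguments.
Unset Strict Implicit.
Unset Printing Implicit Defensive.

Import Order.TTheory GRing.Theory Num.Theory.
Import numFieldNormedType.Exports.

Local Open Scope classical_set_scope.
Local Open Scope ring_scope.

(** * Subgroups and finite index *)

Section Subgroups.
Context {G : groupType}.
Implicit Types (H K : set G) (x y : G).
Local Open Scope group_scope.

Lemma subgroupP H : is_subgroup H <-> H 1 /\ forall x y, H x -> H y -> H (x / y).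
Proof.
split=> [[h1 h2]|[h1 h2]]; split.
- by have := h1; rewrite inE.
- by move=> x y hx hy; have := h2 x y; rewrite !inE; exact.
- by rewrite inE.
- by move=> x y; rewrite !inE; exact: h2.
Qed.

Lemma subgroup1 H : is_subgroup H -> H 1.
Proof. by move=> /subgroupP[]. Qed.

Lemma subgroupV H x : is_subgroup H -> H x -> H x^-1.
Proof. by move=> /subgroupP[h1 h2] hx; rewrite -(mul1g x^-1); exact: h2. Qed.

Lemma subgroupM H x y : is_subgroup H -> H x -> H y -> H (x * y).
Proof.
move=> sH hx hy; rewrite -(invgK y).
by case/subgroupP: (sH) => _; apply=> //; exact: subgroupV.
Qed.

Lemma subgroupX H x n : is_subgroup H -> H x -> H (x ^+ n).
Proof.
move=> sH hx; elim: n => [|n IH]; first by rewrite expg0; exact: subgroup1.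
by rewrite expgS; exact: subgroupM.
Qed.

Lemma subgroupT : is_subgroup [set: G].
Proof. exact/subgroupP. Qed.

Lemma generated_subgroup (A : set G) : is_subgroup (generated A).
Proof.
apply/subgroupP; split=> [M [sM _]|x y hx hy M MA]; first exact: subgroup1.
have [sM _] := MA.
by apply: subgroupM => //; [exact: hx|apply: subgroupV => //; exact: hy].
Qed.

Lemma sub_generated (A : set G) : A `<=` generated A.
Proof. by move=> x Ax M [_]; exact. Qed.

Lemma generated_min (A H : set G) : is_subgroup H -> A `<=` H -> generated A `<=` H.
Proof. by move=> sH AH x; apply. Qed.

(* Finite index, witnessed by a finite colouring refining the left cosets. *)
Definition colorable K : Prop :=
  exists (T : finType) (c : G -> T), forall x y, c x = c y -> K (x^-1 * y).

End Subgroups.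

Lemma finite_coloring (I : Type) (U : Type) (A : set U) (F : I -> U) :
  finite_set A -> (forall i, A (F i)) ->
  exists (n : nat) (c : I -> 'I_n), forall i j, c i = c j -> F i = F j.
Proof.
(* [U] receives a choice structure, so that its elements can be indexed in a sequence. *)
elim/Pchoice: U => U in A F *.
move=> /finite_seqP[s ->] AF.
have lts i : (index (F i) s < size s)%N by rewrite index_mem; exact: AF.
exists (size s), (fun i => Ordinal (lts i)) => i j [] /(congr1 (nth (F i) s)).
by rewrite !nth_index //; exact: AF.
Qed.

Lemma nat_coloring (T : finType) (c : nat -> T) : exists i j, (i < j)%N /\ c i = c j.
Proof.
have /injectivePn[i [j + eij]] : ~~ injectiveb (fun i : 'I_(#|T|.+1) => c i).
  apply/negP => /injectiveP /leq_card.
  by rewrite card_ord ltnn.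
rewrite -val_eqE neq_ltn => /orP[] h.
  by exists i, j.
by exists j, i.
Qed.

Section FiniteIndex.
Context {G : groupType}.
Implicit Types (H K : set G) (x y : G).
Local Open Scope group_scope.

(** [finite_coloring] only says that equal colours force equal cosets. Colouring a chosen
    representative of each coset gives the converse as well. *)
Lemma finite_index_exact_coloring H : is_subgroup H -> finite_index H ->
  exists (n : nat) (c : G -> 'I_n), forall x y, c x = c y <-> H (x^-1 * y).
Proof.
move=> sH fH.
have [|n [c0 hc0]] := @finite_coloring G _ _ (fun x => lcoset x H) fH.
  by move=> x; exists x.
have hl x y : lcoset x H = lcoset y H <-> H (x^-1 * y).
  split=> [e|h].
    have : lcoset y H y by exists 1; rewrite ?mulg1 //; exact: subgroup1.
    by rewrite -e => -[h hh <-]; rewrite mulKg.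
  apply/seteqP; split=> _ [z hz <-].
    exists (y^-1 * x * z); last by rewrite -!mulgA mulVKg.
    apply: subgroupM => //; have := subgroupV sH h; by rewrite invgM invgK.
  by exists (x^-1 * y * z); [exact: subgroupM|rewrite -!mulgA mulVKg].
exists n, (fun x => c0 (xget 1 (lcoset x H))) => x y.
have xg z : H (z^-1 * xget 1 (lcoset z H)).
  case: xgetP => [w _ [h hh <-]|/(_ z)]; first by rewrite mulKg.
  by case; exists 1; rewrite ?mulg1 //; exact: subgroup1.
split=> [/hc0/hl h|/hl -> //].
have := subgroupM sH (subgroupM sH (xg x) h) (subgroupV sH (xg y)).
by rewrite invgM invgK -!mulgA mulVKg mulVKg.
Qed.

Lemma finite_index_colorable H : is_subgroup H -> finite_index H -> colorable H.
Proof.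
move=> sH /(finite_index_exact_coloring sH)[n [c hc]].
by exists 'I_n, c => x y /hc.
Qed.

Lemma colorable_transversal K : colorable K ->
  exists s : seq G, forall g, exists2 x, x \in s & K (x^-1 * g).
Proof.
move=> [T [c hc]].
exists [seq xget 1 [set x | c x = t] | t : T] => g.
exists (xget 1 [set x | c x = c g]); first by apply/mapP; exists (c g); rewrite ?mem_enum.
by case: xgetP => [y _ /hc //|/(_ g)]; case.
Qed.

Lemma colorable_finite_index K : is_subgroup K -> colorable K -> finite_index K.
Proof.
move=> sK /colorable_transversal[s hs].
apply: (@sub_finite_set _ _ [set lcoset x K | x in [set` s]]); last first.
  exact/finite_image/finite_seq.
move=> _ [g _ <-]; have [x xs hx] := hs g.
exists x => //; apply/seteqP; split=> _ [z hz <-].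
  exists (g^-1 * x * z); last by rewrite -!mulgA mulVKg.
  by apply: subgroupM => //; have := subgroupV sK hx; rewrite invgM invgK.
by exists (x^-1 * g * z); [exact: subgroupM|rewrite -!mulgA mulVKg].
Qed.

(** Two of the powers [g ^+ 0], ..., [g ^+ #|T|] share a colour, so some [g ^+ d] with
    [0 < d <= #|T|] lies in [K]; such a [d] divides the factorial of [#|T|], which serves all [g] at
    once. *)
Lemma colorable_exponent K : is_subgroup K -> colorable K ->
  exists2 N : nat, (0 < N)%N & forall g, K (g ^+ N).
Proof.
move=> sK [T [c hc]]; exists ((#|T|)`!)%N => [|g]; first exact: fact_gt0.
have /injectivePn[i [j + eij]] :
    ~~ injectiveb (fun i : 'I_(#|T|.+1) => c (g ^+ i)).
  by apply/negP => /injectiveP /leq_card; rewrite card_ord ltnn.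
wlog ltij : i j eij / (i < j)%N.
  move=> W; rewrite -val_eqE neq_ltn => /orP[] h.
    by apply: (W i j) => //; rewrite -val_eqE neq_ltn h.
  by apply: (W j i) => //; rewrite -val_eqE neq_ltn h.
move=> _.
have hK : K (g ^+ (j - i)).
  have := hc _ _ eij; rewrite -{1}(subnKC (ltnW ltij)) expgnDr mulKg //.
have /dvdnP[q ->] : (j - i %| (#|T|)`!)%N.
  apply: dvdn_fact; rewrite subn_gt0 ltij /=.
  by rewrite (leq_trans (leq_subr _ _)) // -ltnS.
by rewrite mulnC expgnA; exact: subgroupX.
Qed.

End FiniteIndex.

(** * Sigma^1 and finite index subgroups *)

Section AdditiveOn.
Context {G : groupType} {U : zmodType}.
Implicit Types (K : set G) (chi : G -> U).

(** The target is any abelian group, to cover both real characters and the projection to the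
    abelianization. *)
Definition additive_on K chi :=
  forall x y, K x -> K y -> chi (x * y)%g = chi x + chi y.

Lemma additive_on1 K chi : is_subgroup K -> additive_on K chi -> chi 1%g = 0.
Proof.
move=> sK ac; have K1 := subgroup1 sK.
by have /esym/eqP := ac _ _ K1 K1; rewrite mulg1 -subr_eq0 addrK => /eqP.
Qed.

Lemma additive_onV K chi x : is_subgroup K -> additive_on K chi -> K x ->
  chi x^-1%g = - chi x.
Proof.
move=> sK ac Kx; apply/eqP; rewrite -addr_eq0 -ac //; last exact: subgroupV.
by rewrite mulVg (additive_on1 sK ac).
Qed.

Lemma additive_onX K chi x n : is_subgroup K -> additive_on K chi -> K x ->
  chi (x ^+ n)%g = chi x *+ n.
Proof.
move=> sK ac Kx; elim: n => [|n IH].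
  by rewrite expg0 mulr0n (additive_on1 sK ac).
by rewrite expgS mulrS ac ?IH //; exact: subgroupX.
Qed.

End AdditiveOn.

Section Connectivity.
Variables (R : realType) (G : groupType).
Implicit Types (K S : set G) (t : seq G) (chi : G -> R).

Lemma characterP (chi : character R G) : additive_on setT chi.
Proof. by case: chi => c h x y _ _; apply: (asboolP _ h). Qed.

Lemma character_expg (chi : character R G) x n : chi (x ^+ n)%g = chi x *+ n.
Proof. exact: (additive_onX _ subgroupT (@characterP chi)). Qed.

(* h is reachable from g inside S in the Cayley graph of t, stated by
   quantifying over the sets closed under edges instead of over paths. *)
Definition linked t S (g h : G) :=
  forall Q : set G, Q g ->
    (forall x y, S x -> S y -> Q x -> cayley_adj t x y -> Q y) -> Q h.

(** The condition defining Sigma^1, stated for a subgroup [K] without making it a group of its own.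
    For [K] the whole group, connectivity itself forces [t] to generate. *)
Definition nonneg_connected K chi := exists t : seq G, (forall x, x \in t -> K x) /\
  forall g h, K g -> K h -> 0 <= chi g -> 0 <= chi h ->
    linked t [set x | K x /\ 0 <= chi x] g h.

Lemma cayley_adjE t x y :
  cayley_adj t x y <-> (x^-1 * y)%g \in t ++ [seq z^-1%g | z <- t].
Proof.
rewrite /cayley_adj mem_cat; split=> /orP[->//|].
  by move=> h; apply/orP; right; apply/mapP; exists (y^-1 * x)%g => //;
    rewrite invgM invgK.
by move=> /mapP[z zt e]; apply/orP; right; rewrite -[X in X \in _]invgK invgM invgK e invgK.
Qed.

Lemma nonneg_part_connectedP t (chi : character R G) :
  nonneg_part_connected t chi <->
  forall g h, 0 <= chi g -> 0 <= chi h ->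
    linked t [set x | setT x /\ 0 <= chi x] g h.
Proof.
split=> [C g h hg hh Q Qg cQ|C g h hg hh].
  have [p [pp ap <-]] := C g h hg hh.
  elim: p g hg Qg pp ap => [//|a p IH] g hg Qg /= /andP[ga pa] ap.
  have ha : 0 <= chi a by apply: ap; rewrite mem_head.
  apply: IH => //; first by apply: (cQ g a).
  by move=> x xp; apply: ap; rewrite inE xp orbT.
pose Q : set G := [set y | exists p, [/\ path (cayley_adj t) g p,
  {in p, forall x, 0 <= chi x} & last g p = y]].
apply: (C g h hg hh Q); first by exists [::].
move=> x y [_ hx] [_ hy] [p [pp ap lp]] axy; exists (rcons p y); split.
- by rewrite rcons_path pp lp.
- by move=> z; rewrite mem_rcons inE => /orP[/eqP->//|]; exact: ap.
- by rewrite last_rcons.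
Qed.

Lemma linked_generated t K chi (M : set G) g : is_subgroup K -> is_subgroup M ->
  additive_on K chi ->
  (forall x, x \in t -> M x) -> K g -> 0 <= chi g ->
  linked t [set x | K x /\ 0 <= chi x] 1%g g -> M g.
Proof.
move=> sK sM ac tM Kg cg; apply; first exact: subgroup1.
move=> x y _ _ Mx /orP[/tM h|/tM h].
  by rewrite -(mulVKg x y); exact: subgroupM.
by rewrite -(mulVKg x y) -[(x^-1 * y)%g]invgK invgM invgK; apply: subgroupM => //; exact: subgroupV.
Qed.

(** An element of nonnegative value is linked to 1, hence is a product of elements of [t] and their
    inverses; otherwise its inverse is. *)
Lemma nonneg_connected_generates chi : additive_on setT chi -> nonneg_connected setT chi ->
  exists2 t : seq G, generates t &
    forall g h, 0 <= chi g -> 0 <= chi h ->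
      linked t [set x | setT x /\ 0 <= chi x] g h.
Proof.
move=> ac [t [_ ht]]; exists t; last by move=> g h; exact: ht.
have sM : is_subgroup (generated [set` t]) by exact: generated_subgroup.
have c1 := additive_on1 subgroupT ac.
have gen g : 0 <= chi g -> generated [set` t] g.
  move=> hg; apply: (@linked_generated t setT chi) => //; first exact: subgroupT.
    by move=> x xt; exact: sub_generated.
  by apply: ht; rewrite ?c1.
apply/seteqP; split=> // g _.
have [/gen//|lt0] := leP 0 (chi g).
rewrite -(invgK g); apply: (subgroupV sM); apply: gen.
by rewrite (additive_onV subgroupT ac) // oppr_ge0 ltW.
Qed.

Lemma nonneg_connected_zero t : generates t -> nonneg_connected [set: G] (fun=> 0).
Proof.
move=> gt; exists t; split=> // g h _ _ _ _ Q Qg cQ.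
(* The right translations preserving [Q] form a subgroup; it contains [t], hence everything. *)
pose M : set G := [set x | forall y, Q y <-> Q (y * x)%g].
have sM : is_subgroup M.
  apply/subgroupP; split=> [y|x y Mx My z]; first by rewrite mulg1.
  have [Mx1 Mx2] := Mx z; have [My1 My2] := My (z * (x / y))%g.
  rewrite -mulgA mulgVK in My1 My2.
  by split=> [/Mx1/My2|/My1/Mx2].
have hM : [set` t] `<=` M.
  move=> x xt y; split=> Qy; first apply: (cQ y (y * x)%g) => //.
    by apply/orP; left; rewrite mulKg.
  by apply: (cQ (y * x)%g y) => //; apply/orP; right; rewrite mulKg.
have : generated [set` t] (g^-1 * h)%g by rewrite gt.
by move=> /(generated_min sM hM)/(_ g); rewrite mulVKg => -[+ _]; exact.
Qed.

Lemma nonneg_connected_eq K chi chi' : (forall x, K x -> chi x = chi' x) ->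
  nonneg_connected K chi -> nonneg_connected K chi'.
Proof.
move=> e [t [tK ht]]; exists t; split=> // g h Kg Kh hg hh.
have -> : [set x | K x /\ 0 <= chi' x] = [set x | K x /\ 0 <= chi x].
  by apply/seteqP; split=> x /= [Kx]; rewrite e.
by apply: ht; rewrite ?e.
Qed.

(** Representatives of the cosets [K g] on which [chi] is nonpositive: if [chi] is nonzero, some [z]
    in [K] has negative value, and multiplying by a high power of [z] lowers a representative
    without leaving its coset. *)
Lemma nonpos_transversal K chi : is_subgroup K -> colorable K ->
    additive_on setT chi ->
  exists (s : seq G) (rho : G -> G), forall g,
    [/\ rho g \in s, K (g * (rho g)^-1)%g, chi (rho g) <= 0 &
        K g -> rho g = 1%g].
Proof.
move=> sK cK ac; have [s hs] := colorable_transversal cK.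
have c1 := additive_on1 subgroupT ac.
have [N N0 hN] := colorable_exponent sK cK.
have [X hX] : exists X : seq G, forall g, exists2 x, x \in X & K (g * x^-1)%g /\ chi x <= 0.
  have [[g0 g0n]|chi0] := pselect (exists g, chi g != 0); last first.
    exists [seq x^-1%g | x <- s] => g; have [x xs hx] := hs g^-1%g.
    exists x^-1%g; first exact: map_f.
    split; first by have := subgroupV sK hx; rewrite invgM !invgK.
    by case: (eqVneq (chi x^-1%g) 0) => [->//|h]; case: chi0; exists x^-1%g.
  have [z Kz z0] : exists2 z, K z & chi z < 0.
    have [lt0|] := ltP (chi g0) 0.
      exists (g0 ^+ N)%g => //; rewrite (additive_onX _ subgroupT ac) //.
      by rewrite pmulrn_llt0.
    rewrite le_eqVlt eq_sym (negPf g0n) /= => gt0.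
    exists (g0^-1 ^+ N)%g => //; rewrite (additive_onX _ subgroupT ac) //.
    by rewrite (additive_onV subgroupT ac) // pmulrn_llt0 // oppr_lt0.
  (* Large enough that [n y] times [- chi z] exceeds [chi y]. *)
  pose n y : nat := Num.bound (`|chi y| / (- chi z)).
  exists [seq (z ^+ n x^-1 * x^-1)%g | x <- s] => g.
  have [x xs hx] := hs g^-1%g.
  exists (z ^+ n x^-1 * x^-1)%g; first by apply/mapP; exists x.
  split.
    rewrite invgM !invgK mulgA; apply: subgroupM => //.
      by have := subgroupV sK hx; rewrite invgM !invgK.
    by apply: subgroupV => //; exact: subgroupX.
  rewrite ac // (additive_onX _ subgroupT ac) //.
  have nz : 0 < - chi z by rewrite oppr_gt0.
  have := @archi_boundP R (`|chi x^-1%g| / - chi z).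
  rewrite divr_ge0 ?(ltW nz) // => /(_ isT); rewrite -/(n x^-1%g).
  rewrite ltr_pdivrMr // mulrN mulr_natl => h.
  have := ler_norm (chi x^-1%g); lra.
exists (1%g :: X).
suff /choice[rho hr] : forall g, exists r, [/\ r \in 1%g :: X, K (g * r^-1)%g,
  chi r <= 0 & K g -> r = 1%g] by exists rho.
move=> g; have [Kg|nKg] := pselect (K g).
  by exists 1%g; rewrite mem_head invg1 mulg1 c1.
have [x xX [h1 h2]] := hX g; exists x; split=> //.
by rewrite inE xX orbT.
Qed.

(* A path in G is pushed into K by moving each vertex g to g * (rho g)^-1,
   which does not decrease chi. For chi = 0 this is Schreier's lemma. *)
Lemma nonneg_connected_restrict K chi : is_subgroup K -> colorable K ->
  additive_on setT chi -> nonneg_connected setT chi -> nonneg_connected K chi.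
Proof.
move=> sK cK ac [t [_ ht]].
have [X [rho hr]] := nonpos_transversal sK cK ac.
pose t1 := t ++ [seq z^-1%g | z <- t].
(* Schreier generators: an edge from [x] to [y] labelled by an element of [t1] becomes, after
   pushing, an edge labelled [rho x * (x^-1 * y) * (rho y)^-1]. *)
pose W := [seq (p.1.1 * p.2 * p.1.2^-1)%g | p <- allpairs pair (allpairs pair X X) t1].
exists [seq w <- W | `[< K w >]]; split=> [x|g h Kg Kh hg hh Q Qg cQ].
  by rewrite mem_filter => /andP[/asboolP].
have rhoE y : K y -> (y * (rho y)^-1)%g = y.
  by have [_ _ _ e] := hr y => /e ->; rewrite invg1 mulg1.
have up y : 0 <= chi y -> 0 <= chi (y * (rho y)^-1)%g.
  move=> hy; rewrite ac // (additive_onV subgroupT ac) //.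
  have [_ _ + _] := hr y; lra.
rewrite -(rhoE _ Kh).
apply: (ht g h I I hg hh [set y | Q (y * (rho y)^-1)%g]).
  by rewrite /= rhoE.
move=> x y [_ hx] [_ hy] /= Qx /cayley_adjE xy.
have [rx Kx _ _] := hr x; have [ry Ky _ _] := hr y.
apply: (cQ _ _ _ _ Qx) => //=; rewrite ?up //; try by split=> //; exact: up.
have E : ((x * (rho x)^-1)^-1 * (y * (rho y)^-1) =
  rho x * (x^-1 * y) * (rho y)^-1)%g by rewrite invgM invgK !mulgA.
apply/orP; left; rewrite mem_filter; apply/andP; split.
  by apply/asboolP; apply: subgroupM => //; exact: subgroupV.
rewrite E; apply/mapP; exists ((rho x, rho y), (x^-1 * y)%g) => //.
apply/allpairsP; exists ((rho x, rho y), (x^-1 * y)%g); split=> //.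
by apply/allpairsP; exists (rho x, rho y).
Qed.

(** With the transversal added to the generators, every [g] is joined by one edge to
    [g * (rho g)^-1], which lies in [K] and has no smaller value; the rest of the path runs inside
    [K]. *)
Lemma nonneg_connected_extend K chi : is_subgroup K -> colorable K ->
  additive_on setT chi -> nonneg_connected K chi -> nonneg_connected setT chi.
Proof.
move=> sK cK ac [t [tK ht]].
have [X [rho hr]] := nonpos_transversal sK cK ac.
exists (t ++ X); split=> // g h _ _ hg hh Q Qg cQ.
have up y : 0 <= chi y -> 0 <= chi (y * (rho y)^-1)%g.
  move=> hy; rewrite ac // (additive_onV subgroupT ac) //.
  have [_ _ + _] := hr y; lra.
have [rg Kg _ _] := hr g; have [rh Kh _ _] := hr h.
have E y : ((y * (rho y)^-1)^-1 * y = rho y)%g by rewrite invgM invgK mulgVK.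
apply: (cQ (h * (rho h)^-1)%g h) => //=; try by split=> //; exact: up.
  apply: (ht (g * (rho g)^-1)%g) => //; rewrite ?up //.
    apply: (cQ g (g * (rho g)^-1)%g) => //=; try by split=> //; exact: up.
    by apply/orP; right; rewrite E mem_cat rg orbT.
  move=> x y [Kx hx] [Ky hy] Qx xy; apply: (cQ x y) => //=.
  by move: xy; rewrite /cayley_adj !mem_cat => /orP[]->; rewrite ?orbT.
by apply/orP; left; rewrite E mem_cat rh orbT.
Qed.

Lemma subgroup_generators K (s : seq G) : is_subgroup K -> colorable K -> generates s ->
  exists2 t : seq G, (forall x, x \in t -> K x) & K `<=` generated [set` t].
Proof.
move=> sK cK gs; have ac (L : set G) : additive_on L (fun=> 0 : R) by move=> x y; rewrite addr0.
have [t [tK ht]] := nonneg_connected_restrict sK cK (@ac _) (nonneg_connected_zero gs).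
exists t => // g Kg; apply: (@linked_generated t K (fun=> 0)) => //.
- exact: generated_subgroup.
- by move=> x xt; exact: sub_generated.
- by apply: ht => //; exact: subgroup1.
Qed.

End Connectivity.

(** The automorphism [f'] of [K] carries the Cayley graph of [t] to that of its image, and the
    half-space of [chi] to that of [chi \o f]. *)
Lemma nonneg_connected_comp (R : realType) (G : groupType) (K : set G) (chi : G -> R)
    (f f' : G -> G) : is_subgroup K ->
  (forall x, K x -> K (f x)) -> (forall x, K x -> K (f' x)) ->
  (forall x, K x -> f (f' x) = x) -> (forall x, K x -> f' (f x) = x) ->
  (forall x y, K x -> K y -> f (x * y)%g = (f x * f y)%g) ->
  nonneg_connected K chi -> nonneg_connected K (chi \o f).
Proof.
move=> sK fK f'K ff' f'f fM [t [tK ht]].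
have f'M x y : K x -> K y -> f' (x^-1 * y)%g = ((f' x)^-1 * f' y)%g.
  move=> Kx Ky; have Kx' := f'K _ Kx; have Ky' := f'K _ Ky.
  have Kz : K ((f' x)^-1 * f' y)%g by apply: subgroupM => //; exact: subgroupV.
  rewrite -(f'f _ Kz); congr f'; apply: (mulgI x).
  by rewrite mulVKg -{1}(ff' x Kx) -fM // mulVKg ff'.
exists [seq f' x | x <- t]; split=> [x /mapP[y /tK Ky ->]|]; first exact: f'K.
move=> g h Kg Kh hg hh Q Qg cQ.
rewrite -(f'f h Kh); apply: (ht (f g) (f h) _ _ _ _ [set y | Q (f' y)]) => //=;
  rewrite ?f'f //; try exact: fK.
move=> x y [Kx hx] [Ky hy] Qx xy; apply: (cQ _ _ _ _ Qx).
- by split; [exact: f'K|rewrite /= ff'].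
- by split; [exact: f'K|rewrite /= ff'].
- by rewrite /cayley_adj -!f'M //; case/orP: xy => xt; apply/orP; [left|right]; exact: map_f.
Qed.

(** * The first Betti number *)

(** A rational vector in the left kernel exists for rank reasons; the product [D] of its
    denominators makes it integral. *)
Lemma int_dependence (n d : nat) (A : 'I_n -> 'I_d -> int) : (d < n)%N ->
  exists2 k : 'I_n -> int, exists i, k i != 0 &
    forall j, \sum_i k i * A i j = 0.
Proof.
move=> ltdn; pose M : 'M[rat]_(n, d) := \matrix_(i, j) (A i j)%:~R.
have /rowV0Pn[v /sub_kermxP vM v0] : kermx M != 0.
  rewrite kermx_eq0 /row_free; apply: contraTneq ltdn => <-.
  by rewrite -leqNgt rank_leq_col.
pose D := \prod_i denq (v 0 i).
have D0 : D != 0 by apply/prodf_neq0 => i _; exact: denq_neq0.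
have hk i : exists k : int, k%:~R = D%:~R * v 0 i.
  exists (numq (v 0 i) * \prod_(j | j != i) denq (v 0 j)).
  rewrite /D [in RHS](bigD1 i) //= !rmorphM /= [RHS]mulrAC; congr (_ * _).
  by rewrite [RHS]mulrC -[X in _ = X * _]divq_num_den divfK // intr_eq0 denq_neq0.
have [k kE] := choice hk.
exists k => [|j].
  have /rV0Pn[i vi] := v0; exists i.
  by rewrite -(intr_eq0 rat) kE mulf_neq0 // intr_eq0.
apply/eqP; rewrite -(intr_eq0 rat) rmorph_sum /=.
have := congr1 (fun B : 'rV_d => D%:~R * B 0 j) vM.
rewrite !mxE mulr0 => e; apply/eqP; rewrite -[RHS]e.
by rewrite mulr_sumr; apply: eq_bigr => i _; rewrite rmorphM /= kE mxE mulrA.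
Qed.

(** * The quotient by the derived subgroup as an abelian group *)

Section Abelianization.
Variable G : groupType.
Local Notation D := (derived [set: G]).

Lemma derived_subgroup (H : set G) : is_subgroup (derived H).
Proof. exact: generated_subgroup. Qed.

Lemma commg_derived (x y : G) : D [~ x, y]%g.
Proof. by apply: sub_generated; exists x => //; exists y. Qed.

Lemma derivedJ (x y : G) : D x -> D (x ^ y)%g.
Proof.
move=> Dx; have -> : (x ^ y = x * [~ x, y])%g by rewrite mulVKg.
exact: subgroupM (derived_subgroup _) Dx (commg_derived _ _).
Qed.

Definition ab_rel : rel G := fun x y => `[< D (x^-1 * y)%g >].

Lemma ab_relP x y : reflect (D (x^-1 * y)%g) (ab_rel x y).
Proof. exact: asboolP. Qed.

Lemma ab_rel_refl : reflexive ab_rel.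
Proof. by move=> x; apply/ab_relP; rewrite mulVg; exact: subgroup1 (derived_subgroup _). Qed.

Lemma ab_rel_sym : symmetric ab_rel.
Proof.
suff h x y : ab_rel x y -> ab_rel y x by move=> x y; apply/idP/idP => /h.
move=> /ab_relP/(subgroupV (derived_subgroup _)).
by rewrite invgM invgK => ?; apply/ab_relP.
Qed.

Lemma ab_rel_trans : transitive ab_rel.
Proof.
move=> y x z /ab_relP xy /ab_relP yz; apply/ab_relP.
by have := subgroupM (derived_subgroup _) xy yz; rewrite -mulgA mulVKg.
Qed.

Canonical ab_equiv := EquivRel ab_rel ab_rel_refl ab_rel_sym ab_rel_trans.

Definition abelianization := {eq_quot ab_rel}%qT.
HB.instance Definition _ := Choice.on abelianization.

Definition ab (x : G) : abelianization := (\pi_({eq_quot ab_rel}) x)%qT.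

Lemma ab_eqP x y : ab x = ab y <-> D (x^-1 * y)%g.
Proof. by split=> [/eqmodP/ab_relP|h] //; apply/eqmodP/ab_relP. Qed.

Lemma ab_repr (a : abelianization) : ab (repr a) = a.
Proof. exact: reprK. Qed.

Let zero : abelianization := ab 1%g.
Let add (a b : abelianization) : abelianization := ab (repr a * repr b)%g.
Let opp (a : abelianization) : abelianization := ab (repr a)^-1%g.

Let addE x y : add (ab x) (ab y) = ab (x * y)%g.
Proof.
have := ab_repr (ab x); have := ab_repr (ab y); rewrite /add.
move: (repr _) (repr _) => x' y' /ab_eqP hy /ab_eqP hx; apply/ab_eqP.
have -> : ((x' * y')^-1 * (x * y) = (x'^-1 * x) ^ y' * (y'^-1 * y))%g.
  by rewrite conjgE invgM !mulgA mulgK.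
exact: subgroupM (derived_subgroup _) (derivedJ _ hx) hy.
Qed.

Let addA : associative add.
Proof. by move=> a b c; rewrite -(ab_repr a) -(ab_repr b) -(ab_repr c) !addE mulgA. Qed.

Let addC : commutative add.
Proof.
move=> a b; rewrite -(ab_repr a) -(ab_repr b) !addE; apply/ab_eqP.
have -> : forall x y : G, ((x * y)^-1 * (y * x) = [~ y, x])%g.
  by move=> x y; rewrite /commg conjgE invgM !mulgA.
exact: commg_derived.
Qed.

Let add0 : left_id zero add.
Proof. by move=> a; rewrite -(ab_repr a) addE mul1g. Qed.

Let addN : left_inverse zero opp add.
Proof. by move=> a; rewrite -{2}(ab_repr a) addE mulVg. Qed.

HB.instance Definition _ := GRing.isZmodule.Build abelianization addA addC add0 addN.

Lemma abM : additive_on setT ab.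
Proof. by move=> x y _ _; rewrite -addE. Qed.

Lemma ab_eq0 x : ab x = 0 <-> D x.
Proof.
have -> : (0 : abelianization) = ab 1%g by [].
split=> [/esym/ab_eqP|h]; first by rewrite invg1 mul1g.
by apply/esym/ab_eqP; rewrite invg1 mul1g.
Qed.

End Abelianization.

Lemma additive_on_expgz (G : groupType) (U : zmodType) (K : set G) (F : G -> U) x k :
  is_subgroup K -> additive_on K F -> K x -> F (expgz x k) = F x *~ k.
Proof.
move=> sK aF Kx; case: k => n /=; first by rewrite (additive_onX _ sK aF).
by rewrite (additive_onV sK aF) ?(additive_onX _ sK aF) // ?NegzE ?mulrNz //; exact: subgroupX.
Qed.

(** The elements of [K] with such an expansion form a subgroup containing [t]. This is how finite
    generation enters both the bound on the Betti number and the integrality of eigenvalues. *)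
Lemma additive_on_span (G : groupType) (U : zmodType) (K : set G) (F : G -> U)
    (t : seq G) : is_subgroup K -> additive_on K F -> (forall x, x \in t -> K x) ->
  forall x, generated [set` t] x ->
  exists a : 'I_(size t) -> int, F x = \sum_(j < size t) F (nth 1%g t j) *~ a j.
Proof.
move=> sK aF tK.
pose M : set G := [set x | K x /\
  exists a : 'I_(size t) -> int, F x = \sum_(j < size t) F (nth 1%g t j) *~ a j].
suff h : generated [set` t] `<=` M by move=> x /h[].
apply: generated_min.
  apply/subgroupP; split.
    split; first exact: subgroup1.
    by exists (fun=> 0); rewrite (additive_on1 sK aF) big1 // => i _; rewrite mulr0z.
  move=> x y [Kx [a ea]] [Ky [b eb]]; have Ky' := subgroupV sK Ky.
  split; first exact: subgroupM.
  exists (fun j => a j - b j); rewrite aF // (additive_onV sK aF) // ea eb -sumrB.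
  by apply: eq_bigr => j _; rewrite mulrzBr.
move=> x /= xt; split; first exact: tK.
have lt : (index x t < size t)%N by rewrite index_mem.
exists (fun j => (j == Ordinal lt)%:Z).
rewrite (bigD1 (Ordinal lt)) //= eqxx mulr1z nth_index // big1 ?addr0 // => j /negPf ->.
by rewrite mulr0z.
Qed.

Section Betti.
Variables (R : realType) (G : groupType).
Implicit Types (K : set G) (s : seq G).

Lemma ab_prod_expgz n (g : 'I_n -> G) (k : 'I_n -> int) :
  ab (\prod_(i < n) expgz (g i) (k i))%g = \sum_i ab (g i) *~ k i.
Proof.
rewrite (big_morph (@ab G) (fun x y => @abM G x y I I) (erefl : ab 1%g = 0)).
apply: eq_bigr => i _; exact: (additive_on_expgz _ subgroupT (@abM G)).
Qed.

Lemma ab_independent_leq_size s n (g : 'I_n -> G) :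
  generates s -> ab_independent setT g -> (n <= size s)%N.
Proof.
move=> gs [_ ind]; rewrite leqNgt; apply/negP => lt.
have span i : exists a : 'I_(size s) -> int,
    ab (g i) = \sum_(j < size s) ab (nth 1%g s j) *~ a j.
  by apply: (additive_on_span subgroupT (@abM G)) => //; rewrite gs.
have [A hA] := choice span.
have [k [i ki] hk] := int_dependence A lt.
suff /ind/(_ i)/eqP : derived setT (\prod_(i < n) expgz (g i) (k i))%g by rewrite (negPf ki).
apply/ab_eq0; rewrite ab_prod_expgz.
under eq_bigr do rewrite hA mulrz_suml.
rewrite exchange_big big1 // => j _.
under eq_bigr do rewrite -mulrzA mulrC.
by rewrite -mulrz_sumr hk mulr0z.
Qed.

(** An [x] of infinite order modulo [derived K] could be adjoined to powers of a maximal independent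
    family of [G], making the Betti number of [K] larger than that of [G]. *)
Lemma betti1_eq_torsion K s : generates s -> is_subgroup K -> colorable K ->
  betti1 R K = betti1 R [set: G] ->
  forall x, K x -> derived setT x -> exists2 m, (0 < m)%N & derived K (x ^+ m)%g.
Proof.
move=> gs sK cK eqb x Kx Dx; apply: contrapT => nm.
have [N N0 hN] := colorable_exponent sK cK.
pose P n := `[< exists g : 'I_n -> G, ab_independent setT g >].
have P0 : exists n, P n.
  by exists 0%N; apply/asboolP; exists (fun=> 1%g); split=> // k _ [].
have Pb n : P n -> (n <= size s)%N.
  by move=> /asboolP[g]; exact: ab_independent_leq_size.
case: (ex_maxnP P0 Pb) => n /asboolP[g [_ ind]] maxn.
have le : (betti1 R [set: G] <= n%:R%:E)%E.
  by apply: ge_ereal_sup => _ [m /asboolP/maxn mn <-]; rewrite lee_fin ler_nat.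
suff ge : (n.+1%:R%:E <= betti1 R K)%E.
  by have := Order.POrderTheory.le_trans ge; rewrite eqb => /(_ _ le);
    rewrite lee_fin ler_nat ltnn.
apply: ereal_sup_ubound; exists n.+1 => //.
(* Index 0 carries [x]; the exponent [N] brings each [g j] into [K]. *)
exists (fun i => if unlift ord0 i is Some j then (g j ^+ N)%g else x).
split=> [i|k]; first by case: unliftP.
rewrite big_ord_recl unlift_none.
under eq_bigr do rewrite liftK.
move=> DK.
have sub : derived K `<=` derived setT.
  apply: generated_min; first exact: derived_subgroup.
  by move=> _ [y Ky [z Kz <-]]; exact: commg_derived.
(* In the abelianization of [G] the class of [x] vanishes, so independence of [g] kills each
   [N * k (lift ord0 j)]. *)
have kl j : k (lift ord0 j) = 0.
  have : derived setT (\prod_(j < n) expgz (g j) (N%:Z * k (lift ord0 j)))%g.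
    apply/ab_eq0; move/sub/ab_eq0: DK.
    rewrite abM // (additive_on_expgz _ subgroupT (@abM G)) //.
    have /ab_eq0 -> := Dx; rewrite mul0rz add0r !ab_prod_expgz => e.
    rewrite -[RHS]e; apply: eq_bigr => i _.
    by rewrite (additive_onX _ subgroupT (@abM G)) // mulrzA.
  by move=> /ind/(_ j)/eqP; rewrite mulf_eq0 eqz_nat gtn_eqF //= => /eqP.
move: DK; rewrite big1 ?mulg1 => [DK|j _]; last by rewrite kl.
have k0 : k ord0 = 0.
  case: (k ord0) DK => [[//|m]|m] /= h; case: nm; exists m.+1 => //.
  by rewrite -(invgK (x ^+ m.+1)%g); exact: subgroupV (derived_subgroup _) h.
by move=> i; case: (unliftP ord0 i) => [j ->|->].
Qed.

Lemma additive_on_derived (K : set G) (chi : G -> R) x : is_subgroup K ->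
  additive_on K chi -> derived K x -> chi x = 0.
Proof.
move=> sK ac; pose M : set G := [set y | K y /\ chi y = 0].
suff h : derived K `<=` M by move=> /h[].
apply: generated_min.
  apply/subgroupP; split=> [|y z [Ky cy] [Kz cz]].
    by split; [exact: subgroup1|exact: additive_on1 sK ac].
  have Kz' := subgroupV sK Kz.
  by split; [exact: subgroupM|rewrite ac // (additive_onV sK ac) // cy cz subr0].
move=> _ [y Ky [z Kz <-]]; have Ky' := subgroupV sK Ky; have Kz' := subgroupV sK Kz.
have Kyz : K (y ^ z)%g by rewrite conjgE; do !apply: subgroupM => //.
split; first by rewrite /commg; exact: subgroupM.
rewrite /commg ac // conjgE !ac //; last exact: subgroupM.
by rewrite !(additive_onV sK ac) //; lra.
Qed.

(* Modulo [G, G] the power map is additive, and its failure to be so in K is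
   a torsion class of K / [K, K], invisible to chi. *)
Lemma additive_on_root K (chi : G -> R) N : is_subgroup K -> additive_on K chi ->
  (forall g, K (g ^+ N)%g) ->
  (forall x, K x -> derived setT x -> exists2 m, (0 < m)%N & derived K (x ^+ m)%g) ->
  additive_on setT (fun g => chi (g ^+ N)%g / N%:R).
Proof.
move=> sK ac hN tors g h _ _; rewrite -mulrDl -ac //; congr (_ / _).
have KgN := hN g; have KhN := hN h; have KghN := hN (g * h)%g.
pose z := (((g * h) ^+ N)^-1 * (g ^+ N * h ^+ N))%g.
have Kz : K z by apply: subgroupM => //; [exact: subgroupV|exact: subgroupM].
have Dz : derived setT z.
  have aX := additive_onX _ subgroupT (@abM G); have aM := @abM G.
  by apply/ab_eq0; rewrite aM // (additive_onV subgroupT aM) // aM // !aX // aM // mulrnDl addNr.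
have [m m0 /(additive_on_derived sK ac)] := tors z Kz Dz.
rewrite (additive_onX _ sK ac) // => /eqP; rewrite mulrn_eq0 gtn_eqF //= => /eqP cz.
have -> : (g ^+ N * h ^+ N = (g * h) ^+ N * z)%g by rewrite mulVKg.
by rewrite ac // cz addr0.
Qed.

End Betti.

(** * Extreme rays of spherical polytopes *)

Lemma connected_component_map (X : topologicalType) (A : set X) (h : X -> X) x y :
  continuous h -> (forall z, A z -> A (h z)) ->
  connected_component A x y -> connected_component A (h x) (h y).
Proof.
move=> ch Ah [B [Bx BA cB] By]; exists (h @` B); last exact: imageP.
split; first exact: imageP.
  by move=> _ [z Bz <-]; apply: Ah; exact: BA.
by apply: connected_continuous_connected => //; exact: continuous_subspaceT.
Qed.

Section Rays.
Variables (R : realType) (G : groupType).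
Implicit Types (v w : nonzero_character R G) (A : set (sphere R G)).

Definition nzc (chi : character R G) (h : chi <> 0) : nonzero_character R G :=
  exist _ chi (mem_set (A := [set c : character R G | c <> 0]) h).

Lemma nonzeroP v : val v <> 0.
Proof. by case: v => chi h; exact: set_mem h. Qed.

Lemma ray_surj (x : sphere R G) : exists v, x = ray v.
Proof. by exists (repr x); rewrite /ray reprK. Qed.

(** Extreme rays of the cone over a component. No vertices are mentioned, so the notion is carried
    along by linear homeomorphisms preserving [A]. *)
Definition extreme A v := A (ray v) /\
  forall u w, connected_component A (ray v) (ray u) ->
    connected_component A (ray v) (ray w) -> val v = val u + val w -> ray u = ray v.

Lemma spherical_hullP m (p : 'I_m -> character R G) v :
  spherical_hull p (ray v) <->
  exists2 b : 'I_m -> R, (forall j, 0 <= b j) & val v = \sum_j b j *: p j.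
Proof.
split=> [[w [a a0 ew] /ray_eqP[r r0 e]]|h]; last by exists v.
exists (fun j => r^-1 * a j) => [j|]; first by rewrite mulr_ge0 // invr_ge0 ltW.
under eq_bigr do rewrite -scalerA.
by rewrite -scaler_sumr -ew e scalerA mulVf ?scale1r // gt_eqF.
Qed.

Lemma vertex_neq0 P m (p : 'I_m -> character R G) j : polytope_vertices P p -> p j <> 0.
Proof. by move=> [[f /(_ j) fp] _ _] e; move: fp; rewrite e raddf0 ltxx. Qed.

(** Split off one vertex with positive coefficient, [v = b j *: p j + q]. Unless [q = 0], both
    summands lie in the cone, and extremality makes the first proportional to [v]. *)
Lemma extreme_is_vertex A P m (p : 'I_m -> character R G) v :
  polytope_vertices P p -> connected_component A (ray v) = P -> extreme A v ->
  exists j c, 0 < c /\ val v = c *: p j.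
Proof.
move=> pp eP [Av ext].
have [[f fp] hP _] := pp.
have : P (ray v) by rewrite -eP; exact: connected_component_refl.
rewrite hP => /spherical_hullP[b b0 ev].
have [j bj] : exists j, b j != 0.
  apply: contrapT => nb; apply: (nonzeroP (v := v)); rewrite ev big1 // => j _.
  by case: (eqVneq (b j) 0) => [->|h]; [rewrite scale0r|case: nb; exists j].
have bj0 : 0 < b j by rewrite lt_neqAle eq_sym bj b0.
pose q := \sum_(i < m | i != j) b i *: p i.
have evq : val v = b j *: p j + q by rewrite ev (bigD1 j).
have [q0|qn0] := eqVneq q 0; first by exists j, (b j); rewrite evq q0 addr0.
have u0 : b j *: p j <> 0.
  move=> /eqP; rewrite scaler_eq0 (negPf bj) /= => /eqP; exact: vertex_neq0 pp.
have inP w (a : 'I_m -> R) : (forall i, 0 <= a i) -> val w = \sum_i a i *: p i ->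
    connected_component A (ray v) (ray w).
  by move=> a0 ew; rewrite eP hP; apply/spherical_hullP; exists a.
have : ray (nzc u0) = ray v.
  apply: (ext _ (nzc (elimN eqP qn0))) => //=.
    apply: (inP _ (fun i => if i == j then b j else 0)) => [i|/=].
      by case: ifP => //.
    rewrite (bigD1 j) //= eqxx big1 ?addr0 // => i /negPf ->; exact: scale0r.
  apply: (inP _ (fun i => if i == j then 0 else b i)) => [i|/=].
    by case: ifP => //.
  rewrite [RHS](bigD1 j) //= eqxx scale0r add0r.
  by apply: eq_bigr => i /negPf ->.
move=> /ray_eqP[r r0 /= e]; exists j, (r^-1 * b j); split.
  by rewrite mulr_gt0 // invr_gt0.
by rewrite -scalerA e scalerA mulVf ?scale1r // gt_eqF.
Qed.

(** If [p i = u + w] in the cone, adding coefficients gives [(1 - c i) *: p i] as a nonnegative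
    combination of the other vertices. Minimality excludes [c i < 1], and positivity of [f] then
    makes [u] a multiple of [p i]. *)
Lemma vertex_is_extreme A x m (p : 'I_m -> character R G) i (pi0 : p i <> 0) :
  polytope_vertices (connected_component A x) p ->
  extreme A (nzc pi0).
Proof.
move=> [[f fp] hP min].
have cx : connected_component A x (ray (nzc pi0)).
  rewrite hP; apply/spherical_hullP; exists (fun j => (j == i)%:R) => [j|].
    exact: ler0n.
  rewrite (bigD1 i) //= eqxx scale1r big1 ?addr0 // => j /negPf ->; exact: scale0r.
split; first exact: (connected_component_sub cx).
move=> u w; rewrite -(same_connected_component cx) hP.
move=> /spherical_hullP[a a0 eu] /spherical_hullP[b b0 ew] /= e.
pose c j := a j + b j.
have c0 j : 0 <= c j by rewrite addr_ge0.
have ec : p i = \sum_j c j *: p j.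
  by rewrite e eu ew -big_split; apply: eq_bigr => j _ /=; rewrite scalerDl.
have ec1 : (1 - c i) *: p i = \sum_(j | j != i) c j *: p j.
  by rewrite scalerBl scale1r {1}ec (bigD1 i) //= addrAC subrr add0r.
have fec : (1 - c i) * f (p i) = \sum_(j | j != i) c j * f (p j).
  have := congr1 f ec1; rewrite linearZ linear_sum /= => ->.
  by apply: eq_bigr => j _; rewrite linearZ.
have [lt1|ge1] := ltP (c i) 1.
  have d0 : 0 < 1 - c i by rewrite subr_gt0.
  (* Minimality speaks of strictly positive coefficients, so the zero ones are dropped from the
     index set. *)
  have := min i [set j | (j != i) && (c j != 0)]%SET (fun j => (1 - c i)^-1 * c j).
  case.
  - by rewrite inE eqxx.
  - move=> j; rewrite inE => /andP[_ cj].
    by rewrite mulr_gt0 // ?invr_gt0 // lt_neqAle eq_sym cj c0.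
  - under eq_bigr do rewrite -scalerA.
    rewrite -scaler_sumr.
    have -> : \sum_(j in [set j | (j != i) && (c j != 0)]%SET) c j *: p j =
              \sum_(j | j != i) c j *: p j.
      rewrite [RHS](bigID (fun j => c j == 0)) /=.
      rewrite [X in _ = X + _]big1 ?add0r => [|j /andP[_ /eqP ->]].
        by apply: eq_bigl => j; rewrite inE.
      exact: scale0r.
    by rewrite -ec1 scalerA mulVf ?scale1r // gt_eqF.
(* Here [1 <= c i]: in [fec] the left side is nonpositive and the right side is a sum of nonnegative
   terms, so all these terms vanish. *)
have nn j : j != i -> 0 <= c j * f (p j) by move=> _; rewrite mulr_ge0 // ltW.
have s0 : \sum_(j | j != i) c j * f (p j) == 0.
  apply/eqP/le_anti; rewrite sumr_ge0 // -fec.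
  by rewrite andbT pmulr_lle0 // subr_le0.
have cz j : j != i -> c j = 0.
  move=> ji; move: s0; rewrite psumr_eq0 // => /allP/(_ j (mem_index_enum _)).
  by rewrite ji /= mulf_eq0 (gt_eqF (fp j)) orbF => /eqP.
have az j : j != i -> a j = 0.
  by move=> ji; have := cz j ji; rewrite /c; have := a0 j; have := b0 j; lra.
have eu1 : val u = a i *: p i.
  by rewrite eu (bigD1 i) //= big1 ?addr0 // => j /az ->; exact: scale0r.
apply/ray_eqP; exists (a i) => //; rewrite lt_neqAle a0 andbT eq_sym.
by apply/eqP => ai0; apply: (nonzeroP (v := u)); rewrite eu1 ai0 scale0r.
Qed.

Lemma finite_extreme A :
  finite_set [set connected_component A x | x in A] ->
  (forall x, A x -> transcendental_polytope (connected_component A x)) ->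
  finite_set [set ray v | v in extreme A].
Proof.
move=> fA tA.
apply: (@sub_finite_set _ _ (\bigcup_(P in [set connected_component A x | x in A])
   [set ray v | v in [set v | extreme A v /\ connected_component A (ray v) = P]])).
  move=> _ [v ev <-]; exists (connected_component A (ray v)).
    by exists (ray v) => //; case: ev.
  by exists v.
apply: bigcup_finite => // _ [x Ax <-] /=.
have [m [p [pp _]]] := tA x Ax.
apply: (@sub_finite_set _ _ (range (fun j => ray (nzc (vertex_neq0 (j := j) pp))))).
  move=> _ [v [ev eP] <-].
  have [j [c [c0 e]]] := extreme_is_vertex pp eP ev.
  exists j => //; apply/ray_eqP; exists c^-1; first by rewrite invr_gt0.
  by rewrite e scalerA mulVf ?scale1r // gt_eqF.
exact/finite_image/finite_finset.
Qed.

Lemma transcendentalZ (chi : character R G) c : c != 0 ->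
  transcendental chi -> transcendental (c *: chi).
Proof.
move=> c0 tr a b [x _ <-] [y _ <-].
have e z : (c *: chi) z = c * chi z by [].
rewrite !e !mulf_eq0 !negb_or c0 /= => x0 y0.
rewrite -mulf_div divff // mul1r.
by apply: tr.
Qed.

Lemma extreme_transcendental A v :
  (forall x, A x -> transcendental_polytope (connected_component A x)) ->
  extreme A v -> transcendental (val v).
Proof.
move=> tA ev; have [Av _] := ev; have [m [p [pp trp]]] := tA _ Av.
have [j [c [c0 ->]]] := extreme_is_vertex pp erefl ev.
by apply: transcendentalZ => //; rewrite gt_eqF.
Qed.

Lemma exists_extreme A : A !=set0 ->
  (forall x, A x -> transcendental_polytope (connected_component A x)) ->
  exists v, extreme A v.
Proof.
move=> [x Ax] tA; have [m [p [pp _]]] := tA x Ax.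
have [v xv] := ray_surj x.
(* With [m = 0] the hull would contain no nonzero character. *)
have [j _] : exists j : 'I_m, true.
  have : connected_component A x (ray v) by rewrite -xv; exact: connected_component_refl.
  have [_ -> _] := pp; move=> /spherical_hullP[b _ ev].
  apply: contrapT => nj; apply: (nonzeroP (v := v)).
  by rewrite ev big1 // => j _; case: nj; exists j.
by exists (nzc (vertex_neq0 (j := j) pp)); exact: vertex_is_extreme pp.
Qed.

End Rays.

(** * The self-map of the character sphere induced by a continuous injective linear map *)

Section LinearHomeomorphism.
Variables (R : realType) (G : groupType) (T T' : {linear character R G -> character R G}).
Hypotheses (TK : cancel T T') (cT : continuous T).

Lemma image_neq0 (v : nonzero_character R G) : T (val v) <> 0.
Proof.
by move=> e; apply: (nonzeroP (v := v)); rewrite -(TK (val v)) e raddf0.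
Qed.

Definition nzmap (v : nonzero_character R G) := nzc (image_neq0 (v := v)).

Definition sphere_map (x : sphere R G) : sphere R G := ray (nzmap (repr x)).

Lemma sphere_map_ray v : sphere_map (ray v) = ray (nzmap v).
Proof.
have /ray_eqP[r r0 e] : ray (repr (ray v)) = ray v by rewrite /ray reprK.
by apply/ray_eqP; exists r; rewrite //= e linearZ.
Qed.

Lemma sphere_map_continuous : continuous sphere_map.
Proof.
have cn : continuous nzmap.
  apply: continuous_comp_initial => v.
  apply: (@continuous_comp _ _ _ (val : nonzero_character R G -> character R G) T).
    exact: initial_continuous.
  exact: cT.
apply/quotient_continuous.
have -> : sphere_map \o \pi_(sphere R G)%qT = (@ray R G) \o nzmap.
  by apply/funext => v; exact: sphere_map_ray.
move=> v; apply: continuous_comp; first exact: cn.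
exact: pi_continuous.
Qed.

End LinearHomeomorphism.

(** * The induced action on characters *)

(** Viewed in [algC], [q] is a rational algebraic integer. *)
Lemma rat_root_monic_int (p : {poly int}) (q : rat) : p \is monic ->
  root (map_poly intr p) q -> exists m : int, q = m%:~R.
Proof.
move=> mp rq.
have mp' : map_poly intr p \is @monic algC by exact: monic_map.
have rq' : root (map_poly intr p) (ratr q : algC).
  have := rq; rewrite -(fmorph_root (@ratr algC)) -map_poly_comp.
  congr (is_true (root _ _)); apply: eq_map_poly => z /=; exact: ratr_int.
have /root_monic_Aint/(_ mp') := rq'.
have po : map_poly intr p \is a polyOver (Num.int : {pred algC}).
  by apply/polyOverP => i; rewrite coef_map /=; exact: intr_int.
move=> /(_ po)/(Cint_rat_Aint (Crat_rat q))/intrP[m e]; exists m.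
by apply: (fmorph_inj (@ratr algC)); rewrite /= ratr_int.
Qed.

(** The row [u] is an eigenvector of the transpose of [A], so [r] is a root of a characteristic
    polynomial, monic over the integers. *)
Lemma integral_eigenvalue (R : realType) n (u : 'I_n -> R) (A : 'I_n -> 'I_n -> int) r :
  (exists j, u j != 0) -> (forall j, r * u j = \sum_l u l *~ A j l) ->
  algebraicOver (ratr : rat -> R) r /\
  forall q, r = ratr q -> exists m : int, q = m%:~R.
Proof.
move=> [j0 uj0] hA.
pose B : 'M[int]_n := \matrix_(l, j) A j l.
have rB : root (map_poly intr (char_poly B)) r.
  rewrite map_char_poly -eigenvalue_root_char; apply/eigenvalueP.
  exists (\row_j u j); last by apply/rV0Pn; exists j0; rewrite mxE.
  apply/rowP => j; rewrite !mxE hA; apply: eq_bigr => l _.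
  by rewrite !mxE mulrzr.
have cm := char_poly_monic B.
have ratr_char : map_poly (ratr : rat -> R) (map_poly intr (char_poly B)) =
    map_poly intr (char_poly B).
  by rewrite -map_poly_comp; apply: eq_map_poly => z /=; exact: ratr_int.
split=> [|q rq].
  exists (map_poly intr (char_poly B)); last by rewrite ratr_char.
  by apply/monic_neq0/monic_map.
apply: (rat_root_monic_int cm).
by rewrite -(fmorph_root (@ratr R)) ratr_char /= -rq.
Qed.

Section Eigencharacter.
Variables (R : realType) (G : groupType) (K : set G) (t : seq G).
Hypotheses (sK : is_subgroup K) (tK : forall x, x \in t -> K x).
Hypothesis gK : K `<=` generated [set` t].
Implicit Types (v : character R G) (f : G -> G).

(** The values of [v] on the generators form the eigenvector: [v] at the image of a generator is an
    integer combination of them. *)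
Lemma eigencharacter_integral v f (r : R) : (exists2 k, K k & v k != 0) ->
  (forall k, K k -> K (f k)) -> (forall k, K k -> v (f k) = r * v k) ->
  algebraicOver (ratr : rat -> R) r /\
  forall q, r = ratr q -> exists m : int, q = m%:~R.
Proof.
move=> [k Kk vk] fK fv.
have av : additive_on K v by move=> x y _ _; exact: characterP.
have span x : K x -> exists a : 'I_(size t) -> int,
    v x = \sum_(j < size t) v (nth 1%g t j) *~ a j.
  by move=> /gK; exact: (additive_on_span sK av tK).
have Kt (j : 'I_(size t)) : K (nth 1%g t j) by apply/tK/mem_nth.
have [A hA] := choice (fun j : 'I_(size t) => span _ (fK _ (Kt j))).
apply: (@integral_eigenvalue R _ (fun j : 'I_(size t) => v (nth 1%g t j)) A).
  apply: contrapT => nj; have [a ea] := span _ Kk.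
  move: vk; rewrite ea big1 ?eqxx // => j _.
  case: (eqVneq (v (nth 1%g t j)) 0) => [->|h]; first by rewrite mul0rz.
  by case: nj; exists j.
by move=> j; rewrite -fv // hA.
Qed.

(* r is an algebraic integer, and so is its inverse; being a ratio of values
   of v it is rational, hence a positive unit of the integers. *)
Lemma transcendental_eigenvalue v f f' (r : R) : transcendental v ->
  (exists2 k, K k & v k != 0) -> 0 < r ->
  (forall k, K k -> K (f k)) -> (forall k, K k -> v (f k) = r * v k) ->
  (forall k, K k -> K (f' k)) -> (forall k, K k -> f (f' k) = k) -> r = 1.
Proof.
move=> tr nv r0 fK fv f'K ff'.
have f'v k : K k -> v (f' k) = r^-1 * v k.
  by move=> Kk; rewrite -{2}(ff' k Kk) fv ?mulKf ?gt_eqF //; exact: f'K.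
have [alg hint] := eigencharacter_integral nv fK fv.
have [_ hintV] := eigencharacter_integral nv f'K f'v.
have [k Kk vk] := nv.
have rE : r = v (f k) / v k by rewrite fv // mulfK.
have [[q _ eq]|//] : rational r \/ transcendental_number r.
  rewrite {1 2}rE; apply: tr => //; try by eexists.
  by rewrite fv // mulf_neq0 // gt_eqF.
have [m em] := hint q (esym eq).
have [m' em'] : exists m' : int, q^-1 = m'%:~R by apply: hintV; rewrite -eq fmorphV.
have q0 : 0 < q by move: r0; rewrite -eq ltr0q.
have m0 : 0 < m by move: q0; rewrite em ltr0z.
have mm' : m * m' = 1.
  by apply/eqP; rewrite -(eqr_int rat) rmorphM /= -em -em' mulfV // gt_eqF.
have m'0 : 0 < m' by rewrite -(pmulr_rgt0 _ m0) mm'.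
have : m = 1 by nia.
by move=> m1; rewrite -eq em m1 rmorph1.
Qed.

End Eigencharacter.

Lemma continuous_ptws (X V : topologicalType) (I : choiceType)
    (f : X -> {ptws I -> V}) :
  (forall i, continuous (fun x => f x i)) -> continuous f.
Proof.
move=> cf x; apply/cvg_sup => i.
exact: (@continuous_comp_initial _ _ _ (@proj I (fun=> V) i) f (cf i) x).
Qed.

Lemma eval_continuous (R : realType) (G : groupType) (g : G) :
  continuous (fun chi : character R G => chi g).
Proof.
move=> chi.
have h1 : {for chi, continuous (@char_fun R G : character R G -> {ptws G -> R})}.
  exact: initial_continuous.
have h2 : {for (char_fun chi : {ptws G -> R}),
    continuous (@proj G (fun=> R) g : {ptws G -> R} -> R)}.
  exact: proj_continuous.
exact: (continuous_comp h1 h2).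
Qed.

Section Pullback.
Variables (R : realType) (G : groupType) (K : set G) (N : nat).
Hypotheses (sK : is_subgroup K) (N0 : (0 < N)%N) (KN : forall g : G, K (g ^+ N)%g).

(** Restriction to [K] is injective, since [chi g] is [chi (g ^+ N)] divided by [N]. *)
Lemma character_eq_on (chi chi' : character R G) :
  (forall k, K k -> chi k = chi' k) -> chi = chi'.
Proof.
move=> e; apply/val_inj/funext => g /=.
have := e _ (KN g); rewrite !character_expg => /eqP.
by rewrite -subr_eq0 -mulrnBl mulrn_eq0 gtn_eqF //= subr_eq0 => /eqP.
Qed.

(** The only candidate for the extension of [chi \o psi] from [K] to [G] sends [g] to
    [chi (psi (g ^+ N)) / N]; [additive_on_root] shows that it is a character. *)
Lemma pullback_exists (psi : G -> G) :
  (forall x, K x -> derived setT x -> exists2 m, (0 < m)%N & derived K (x ^+ m)%g) ->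
  (forall k, K k -> K (psi k)) ->
  (forall x y, K x -> K y -> psi (x * y)%g = (psi x * psi y)%g) ->
  exists T : {linear character R G -> character R G}, continuous T /\
    forall chi k, K k -> T chi k = chi (psi k).
Proof.
move=> tors psiK psiM.
have apsi (chi : character R G) : additive_on K (chi \o psi).
  by move=> x y Kx Ky /=; rewrite psiM // characterP.
have charT (chi : character R G) :
    (fun g => chi (psi (g ^+ N)%g) / N%:R) \in @is_character R G.
  apply/asboolP => x y.
  exact: (additive_on_root sK (apsi chi) KN tors).
pose T0 chi := Character (charT chi).
have linT : linear T0.
  move=> a chi chi'; apply/val_inj/funext => g /=.
  rewrite -[LHS]/((a * chi (psi (g ^+ N)%g) + chi' (psi (g ^+ N)%g)) / N%:R).
  by rewrite mulrDl -mulrA.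
pose L := GRing.isLinear.Build R _ _ _ T0 linT.
pose T : {linear character R G -> character R G} := HB.pack T0 L.
exists T; split=> [|chi k Kk]; last first.
  have := additive_onX N sK (apsi chi) Kk => /= e.
  by rewrite /= e -(mulr_natr (chi _)) mulfK // pnatr_eq0 gtn_eqF.
apply/continuous_comp_initial/continuous_ptws => g chi /=.
apply: cvgMr_tmp; first exact: (@nbhs_filter (character R G : topologicalType) chi).
exact: (@eval_continuous R G (psi (g ^+ N)%g) chi).
Qed.

End Pullback.

(** * Twisted conjugacy classes *)

Section MorphismOn.
Variables (G G' : groupType) (K : set G) (F : G -> G').
Hypotheses (sK : is_subgroup K)
  (FM : forall x y, K x -> K y -> F (x * y)%g = (F x * F y)%g).

Lemma morphism_on1 : F 1%g = 1%g.
Proof. by apply: (mulgI (F 1%g)); rewrite -FM ?mulg1 //; exact: subgroup1. Qed.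

Lemma morphism_onV x : K x -> F x^-1%g = (F x)^-1%g.
Proof.
move=> Kx; apply: (mulgI (F x)); rewrite -FM ?mulgV ?morphism_on1 //.
exact: subgroupV.
Qed.

Lemma preimage_subgroup (K' : set G') :
  is_subgroup K' -> is_subgroup [set x | K x /\ K' (F x)].
Proof.
move=> sK'; apply/subgroupP; split.
  by split; [exact: subgroup1|rewrite morphism_on1; exact: subgroup1 sK'].
move=> x y [Kx K'x] [Ky K'y]; have KyV := subgroupV sK Ky.
split; first exact: subgroupM.
by rewrite FM // morphism_onV //; apply: subgroupM => //; exact: subgroupV.
Qed.

(** [F] is multiplicative on [K] only, so [x] is first moved into [K] by a representative of its
    colour; the new colour records both colours. *)
Lemma preimage_colorable (K' : set G') : colorable K -> colorable K' ->
  colorable [set x | K x /\ K' (F x)].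
Proof.
move=> [T [c hc]] [T' [c' hc']].
pose rep x := xget 1%g [set y | c y = c x].
have Krep x : K ((rep x)^-1 * x)%g.
  by rewrite /rep; case: xgetP => [y _ /hc //|/(_ x)]; case.
exists (T * T')%type, (fun x => (c x, c' (F ((rep x)^-1 * x)%g))) => x y [ec].
have er : rep x = rep y by rewrite /rep ec.
have Kx := Krep x; have Ky := Krep y; rewrite er in Kx *.
move=> /hc'; have KxV := subgroupV sK Kx.
have <- : (((rep y)^-1 * x)^-1 * ((rep y)^-1 * y) = x^-1 * y)%g.
  by rewrite invgM invgK -mulgA mulVKg.
by rewrite -morphism_onV // -FM // => K'xy; split=> //; exact: subgroupM.
Qed.

Lemma morphism_on_generated (t : seq G) x : (forall y, y \in t -> K y) ->
  generated [set` t] x -> generated [set` [seq F y | y <- t]] (F x).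
Proof.
move=> tK; have sg := generated_subgroup [set` [seq F y | y <- t]].
suff h : generated [set` t] `<=` [set y | K y /\ generated [set` [seq F y | y <- t]] (F y)].
  by case/h.
apply: generated_min; first exact: preimage_subgroup.
by move=> y yt; split; [exact: tK|apply: sub_generated; exact: map_f].
Qed.

End MorphismOn.

Lemma finite_index_generates (G : groupType) (H : set G) (t : seq G) :
  colorable H -> H `<=` generated [set` t] -> finitely_generated G.
Proof.
move=> /colorable_transversal[X hX] Ht; exists (t ++ X).
have sg := generated_subgroup [set` t ++ X].
apply/seteqP; split=> // g _; have [x xX /Ht hx] := hX g.
rewrite -(mulVKg x g); apply: (subgroupM sg).
  by apply: sub_generated; rewrite /= mem_cat xX orbT.
apply: (generated_min sg) hx => y /= yt.
by apply: sub_generated; rewrite /= mem_cat yt.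
Qed.

Lemma iter_multiplicative (G : groupType) (phi : {multiplicative G -> G}) n :
  {morph iter n phi : x y / (x * y)%g}.
Proof. by elim: n => // n IH x y; rewrite !iterS IH gmulfM. Qed.

(* The action of G on the cosets of H, twisted by phi^i, is determined by the
   generators, so there are finitely many such actions. *)
Lemma finite_index_periodic (G : groupType) (s : seq G) (H : set G)
    (phi : {multiplicative G -> G}) :
  generates s -> is_subgroup H -> finite_index H -> bijective phi ->
  exists2 m, (0 < m)%N & forall x, H (iter m phi x) <-> H x.
Proof.
move=> gs sH fH bphi; have [n [c hc]] := finite_index_exact_coloring sH fH.
have cl a x y : c (a * x)%g = c (a * y)%g <-> c x = c y.
  by rewrite !hc invgM -mulgA mulKg.
pose rep t := xget 1%g [set x | c x = t].
have crep x : c (rep (c x)) = c x by rewrite /rep; case: xgetP => [y _ //|/(_ x)]; case.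
(* The table of the generators acting on cosets through the [i]-th iterate of [phi]. *)
pose data i := [ffun p : 'I_(size s) * 'I_n => c (iter i phi (nth 1%g s p.1) * rep p.2)%g].
have [i [j [ltij eij]]] := nat_coloring data.
(* Elements acting alike through both iterates: a subgroup containing [s], hence everything. *)
pose M : set G := [set x | forall z, c (iter i phi x * z)%g = c (iter j phi x * z)%g].
have iM := iter_multiplicative phi.
have i1 k := morphism_on1 subgroupT (fun x y _ _ => iM k x y).
have iV k x := morphism_onV subgroupT (fun x y _ _ => iM k x y) (I : setT x).
have sM : is_subgroup M.
  apply/subgroupP; split=> [z|x y Mx My z]; first by rewrite !i1.
  rewrite !iM -!mulgA Mx; apply/cl.
  apply/(cl (iter j phi y)); rewrite -My !iV !mulVKg //.
have /(generated_min sM) : [set` s] `<=` M.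
  move=> x /= xs z; have lt : (index x s < size s)%N by rewrite index_mem.
  have /ffunP/(_ (Ordinal lt, c z)) := eij; rewrite !ffunE /= nth_index // => e.
  have /cl <- := crep z; rewrite e; apply/cl; exact: crep.
rewrite gs => MT; exists (j - i)%N; first by rewrite subn_gt0.
have surj k y : exists x, iter k phi x = y.
  have [phi' _ K'] := bphi; elim: k y => [|k IH] y; first by exists y.
  by have [x ex] := IH (phi' y); exists x; rewrite iterS ex K'.
have hH y : H y <-> c y = c 1%g.
  split=> [Hy|/esym/hc]; last by rewrite invg1 mul1g.
  by apply/esym/hc; rewrite invg1 mul1g.
move=> y; have [x <-] := surj i y.
rewrite -iterD subnK ?(ltnW ltij) // !hH.
by have := MT x I 1%g; rewrite !mulg1 => ->.
Qed.

(** Intersect the preimages of [H] under all iterates of [phi]. By periodicity only [m] of them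
    differ, so the index stays finite. *)
Lemma invariant_subgroup (G : groupType) (s : seq G) (H : set G)
    (phi : {multiplicative G -> G}) (phi' : G -> G) :
  generates s -> is_subgroup H -> finite_index H ->
  cancel phi phi' -> cancel phi' phi ->
  exists K : set G, [/\ is_subgroup K, colorable K, K `<=` H,
    forall x, K x -> K (phi x) & forall x, K x -> K (phi' x)].
Proof.
move=> gs sH fH phiK phi'K.
have [m m0 hm] := finite_index_periodic gs sH fH (Bijective phiK phi'K).
have iM := iter_multiplicative phi.
have i1 k := morphism_on1 subgroupT (fun x y _ _ => iM k x y).
have iV k x := morphism_onV subgroupT (fun x y _ _ => iM k x y) (I : setT x).
exists [set x | forall i, H (iter i phi x)]; split.
- apply/subgroupP; split=> [i|x y Kx Ky i]; first by rewrite i1; exact: subgroup1.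
  by rewrite iM iV; apply: subgroupM => //; exact: subgroupV.
- have [T [c hc]] := finite_index_colorable sH fH.
  exists {ffun 'I_m -> T}, (fun x => [ffun i : 'I_m => c (iter i phi x)]) => x y e i.
  have per q j z : H (iter (q * m + j) phi z) <-> H (iter j phi z).
    by elim: q => // q IH; rewrite mulSn -addnA iterD hm.
  rewrite (divn_eq i m); apply/per; rewrite iM iV; apply: hc.
  by have /ffunP/(_ (Ordinal (ltn_pmod i m0))) := e; rewrite !ffunE.
- by move=> x /(_ 0%N).
- by move=> x Kx i; rewrite -iterSr; exact: Kx.
move=> x Kx [|i]; last by rewrite iterSr phi'K; exact: Kx.
(* The zeroth iterate at [phi' x] is traded, by periodicity, for the [m]-th, which is iterate [m.-1]
   at [x]. *)
by apply/hm; rewrite -(prednK m0) iterSr phi'K; exact: Kx.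
Qed.

(** With finitely many classes, two powers of [a] would be twisted conjugate by some [k] in [K];
    applying [u], which cancels [k] against [phi k], gives [i] and [j] with
    [u a *+ i = u a *+ j]. *)
Lemma infinite_twisted_classes (R : realType) (G : groupType) (K : set G)
    (phi : {multiplicative G -> G}) (u : G -> R) :
  is_subgroup K -> colorable K -> (forall x, K x -> K (phi x)) ->
  additive_on K u -> (forall x, K x -> u (phi x) = u x) ->
  (exists2 a, K a & u a != 0) ->
  infinite_set [set twisted_class phi a | a in setT].
Proof.
move=> sK [T [c hc]] phiK au uphi [a Ka ua] fin.
have phi1 := @morphism_on1 _ _ _ phi subgroupT (fun x y _ _ => gmulfM x y).
have phiV x := @morphism_onV _ _ _ phi subgroupT (fun x y _ _ => gmulfM x y) x I.
have [|n [d hd]] := finite_coloring (F := fun i : nat => twisted_class phi (a ^+ i)%g) fin.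
  by move=> i; exists (a ^+ i)%g.
pose b (i : nat) := xget 1%g (twisted_class phi (a ^+ i)%g).
have hs i : exists s, (s * b i * (phi s)^-1)%g = (a ^+ i)%g.
  rewrite /b; case: xgetP => [y _ [s _ <-]|/(_ (a ^+ i)%g)]; last first.
    by case; exists 1%g => //; rewrite phi1 invg1 mulg1 mul1g.
  exists s^-1%g; rewrite phiV invgK !mulgA mulVg mul1g.
  by rewrite mulgVK.
have [s sE] := choice hs.
(* Colouring the inverses puts [s i * (s j)^-1] in [K]. *)
have [i [j [ltij [edij ecij]]]] := nat_coloring (fun i => (d i, c (s i)^-1%g)).
have eb : b i = b j by rewrite /b (hd _ _ edij).
have := hc _ _ ecij; rewrite invgK; set k := (s i * (s j)^-1)%g => Kk.
have e : (a ^+ i = k * a ^+ j * (phi k)^-1)%g.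
  rewrite -(sE i) -(sE j) eb /k gmulfM phiV invgM invgK !mulgA.
  by rewrite mulgVK mulgVK.
have KX p := subgroupX p sK Ka; have Kpk := phiK _ Kk; have KV := subgroupV sK Kpk.
have := congr1 u e; rewrite au //; last exact: subgroupM.
rewrite au // (additive_onV sK au) // uphi // addrAC subrr add0r.
rewrite !(additive_onX _ sK au) // => /eqP; rewrite -subr_eq0 -opprB oppr_eq0.
rewrite -mulrnBr ?(ltnW ltij) // mulrn_eq0 (negPf ua) orbF subn_eq0.
by rewrite leqNgt ltij.
Qed.

(** * A character fixed by an automorphism of a finite index subgroup *)

Section FixedCharacter.
Variables (R : realType) (G : groupType).

Lemma Sigma1P (v : nonzero_character R G) : Sigma1 (ray v) <-> nonneg_connected setT (val v).
Proof.
split=> [[s gs [w hw /ray_eqP[r r0 e]]]|cv].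
  exists s; split=> // g h _ _ hg hh.
  have ev x : (0 <= val v x) = (0 <= val w x).
    by rewrite e -[X in _ = (_ <= X)]/(r * val v x) pmulr_rge0.
  have -> : [set x | setT x /\ 0 <= val v x] = [set x | setT x /\ 0 <= val w x].
    by apply/seteqP; split=> x /= [_]; rewrite ev.
  by have /nonneg_part_connectedP := hw; apply; rewrite -ev.
have [s gs hs] := nonneg_connected_generates (@characterP R G (val v)) cv.
by exists s => //; exists v => //; apply/nonneg_part_connectedP.
Qed.

(** Restrict [chi] to [K], transport along [f], and extend back to [G]. *)
Lemma pullback_Sigma1 (K : set G) (f f' : G -> G)
    (T : {linear character R G -> character R G}) :
  is_subgroup K -> colorable K ->
  (forall x, K x -> K (f x)) -> (forall x, K x -> K (f' x)) ->
  (forall x, K x -> f (f' x) = x) -> (forall x, K x -> f' (f x) = x) ->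
  (forall x y, K x -> K y -> f (x * y)%g = (f x * f y)%g) ->
  (forall chi k, K k -> T chi k = chi (f k)) ->
  forall chi : character R G, nonneg_connected setT chi -> nonneg_connected setT (T chi).
Proof.
move=> sK cK fK f'K ff' f'f fM hT chi /(nonneg_connected_restrict sK cK (@characterP _ _ chi)) cchi.
apply: (nonneg_connected_extend sK cK (@characterP _ _ (T chi))).
have := nonneg_connected_comp sK fK f'K ff' f'f fM cchi.
by apply: nonneg_connected_eq => x Kx; rewrite hT.
Qed.

Lemma exists_fixed_character (K : set G) (f f' : G -> G) :
  finitely_generated G ->
  (forall H : set G, is_subgroup H -> finite_index H ->
     betti1 R H = betti1 R [set: G]) ->
  class_S R G ->
  is_subgroup K -> colorable K ->
  (forall x, K x -> K (f x)) -> (forall x, K x -> K (f' x)) ->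
  (forall x, K x -> f (f' x) = x) -> (forall x, K x -> f' (f x) = x) ->
  (forall x y, K x -> K y -> f (x * y)%g = (f x * f y)%g) ->
  exists w : character R G, (exists2 k, K k & w k != 0) /\
    forall k, K k -> w (f k) = w k.
Proof.
move=> [s gs] hb [_ [A0 [g0 Ag]] fA tA] sK cK fK f'K ff' f'f fM.
have f'M x y : K x -> K y -> f' (x * y)%g = (f' x * f' y)%g.
  move=> Kx Ky; have Kx' := f'K _ Kx; have Ky' := f'K _ Ky.
  by rewrite -{1}(ff' x Kx) -{1}(ff' y Ky) -fM // f'f //; exact: subgroupM.
have tors := betti1_eq_torsion gs sK cK (hb K sK (colorable_finite_index sK cK)).
have [N N0 KN] := colorable_exponent sK cK.
have [T [cT hT]] := pullback_exists R sK N0 KN tors fK fM.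
have [T' [cT' hT']] := pullback_exists R sK N0 KN tors f'K f'M.
have TK : cancel T T'.
  move=> chi; apply: (character_eq_on N0 KN) => k Kk.
  by rewrite hT' // hT ?ff' //; exact: f'K.
have T'K : cancel T' T.
  move=> chi; apply: (character_eq_on N0 KN) => k Kk.
  by rewrite hT // hT' ?f'f //; exact: fK.
set A := ~` @Sigma1 R G in A0 Ag fA tA.
(* [T'] preserves Sigma^1 and undoes [T], so [T] preserves the complement. *)
have AT v : A (ray v) -> A (ray (nzmap TK v)).
  apply: contra_not => /Sigma1P/= h; apply/Sigma1P.
  have := pullback_Sigma1 sK cK f'K fK f'f ff' f'M hT' h.
  by rewrite TK.
have AT' v : A (ray v) -> A (ray (nzmap T'K v)).
  apply: contra_not => /Sigma1P/= h; apply/Sigma1P.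
  have := pullback_Sigma1 sK cK fK f'K ff' f'f fM hT h.
  by rewrite T'K.
have Amap' x : A x -> A (sphere_map T'K x).
  by have [v ->] := ray_surj x; rewrite sphere_map_ray; exact: AT'.
have nzK v : nzmap T'K (nzmap TK v) = v by apply/val_inj; rewrite /= TK.
(* A decomposition of [T v] is pulled back by [T'], which respects components. *)
have extT v : extreme A v -> extreme A (nzmap TK v).
  move=> [Av ext]; split; first exact: AT.
  move=> u w hu hw e.
  have := connected_component_map (sphere_map_continuous (TK := T'K) cT') Amap' hu.
  have := connected_component_map (sphere_map_continuous (TK := T'K) cT') Amap' hw.
  rewrite !sphere_map_ray nzK => cw cu.
  have /= := ext _ _ cu cw; rewrite -raddfD -e /= TK => /(_ erefl).
  move=> /ray_eqP[r r0 /= er]; apply/ray_eqP; exists r => //=.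
  by rewrite -linearZ -er T'K.
have [v0 ev0] := exists_extreme A0 tA.
pose z i := iter i (nzmap TK) v0.
have ez i : extreme A (z i) by elim: i => // i IH; exact: extT.
have [|n [c hc]] := finite_coloring (F := fun i => ray (z i)) (finite_extreme fA tA).
  by move=> i; exists (z i).
(* There are finitely many extreme rays, so the orbit of [v0] repeats a ray and [z i] is an
   eigenvector of a power of [T]. *)
have [i [j [ltij /hc/esym/ray_eqP[r r0 er]]]] := nat_coloring c.
pose p := (j - i)%N; pose v := val (z i).
have zE k : val (iter k (nzmap TK) (z i)) = iter k T v.
  by elim: k => //= k ->.
have Tpv : iter p T v = r *: v.
  by rewrite -zE -iterD subnK ?(ltnW ltij) // -er.
have iterK k x : K x -> K (iter k f x) by move=> Kx; elim: k => //= k /fK.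
have iterK' k x : K x -> K (iter k f' x) by move=> Kx; elim: k => //= k /f'K.
have iterT k chi x : K x -> iter k T chi x = chi (iter k f x).
  move=> Kx; elim: k chi => // k IH chi.
  by rewrite iterSr IH hT //; exact: iterK.
have iterff' k x : K x -> iter k f (iter k f' x) = x.
  elim: k x => // k IH x Kx; rewrite iterS iterSr IH ?ff' //.
  exact: f'K.
have gA u : A (ray u) -> 0 < val u g0.
  move=> /Ag[w hw /ray_eqP[q q0 eq]].
  by move: hw => /=; rewrite eq -[X in _ < X]/(q * val u g0) pmulr_rgt0.
have [t tK gt] := subgroup_generators R sK cK gs.
have nK (chi : character R G) : 0 < chi g0 -> exists2 k, K k & chi k != 0.
  move=> pos; exists (g0 ^+ N)%g => //.
  by rewrite character_expg gt_eqF // pmulrn_lgt0.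
have r1 : r = 1.
  apply: (transcendental_eigenvalue sK tK gt (v := v) (f := iter p f) (f' := iter p f')) => //.
  - exact: extreme_transcendental tA (ez i).
  - by apply/nK/gA; case: (ez i).
  - exact: iterK.
  - by move=> k Kk; rewrite -iterT // Tpv.
  - exact: iterK'.
  - exact: iterff'.
(* The orbit sum: all its terms are positive at [g0], and at least one term occurs since [0 < p]. *)
exists (\sum_(k < p) iter k T v); split.
  apply: nK.
  have sumE (m : nat) (F : 'I_m -> character R G) x : (\sum_i F i) x = \sum_i F i x.
    by elim/big_rec2: _ => // l y1 y2 _ <-.
  rewrite sumE.
  have pos k : 0 < iter k T v g0.
    rewrite -zE; apply: gA; rewrite -iterD; by case: (ez (k + i)%N).
  have -> : p = p.-1.+1 by rewrite prednK // subn_gt0.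
  rewrite big_ord_recl ltr_pwDl // sumr_ge0 // => k _; exact: ltW.
move=> k Kk; rewrite -hT //; congr (char_fun _ k).
rewrite linear_sum /=.
have p0 : p = p.-1.+1 by rewrite prednK // subn_gt0.
(* [T] shifts the terms by one, and the last becomes [iter p T v], equal to the first because
   [r = 1]. *)
rewrite p0 big_ord_recr [RHS]big_ord_recl /= addrC; congr (_ + _).
by rewrite -iterS -p0 Tpv r1 scale1r.
Qed.

End FixedCharacter.

(** * Transfer between commensurable groups *)

Theorem theorem1p1 (R : realType) (G : groupType) :
  finitely_generated G ->
  (forall H : set G, is_subgroup H -> finite_index H ->
     betti1 R H = betti1 R [set: G]%classic) ->
  class_S R G ->
  forall G' : groupType, commensurable G G' -> R_infty G'.
Proof.
move=> fg hb hS G' [H [H' [sH fH sH' fH' [F [[FH Finj Fsurj] FM]]]]] phi.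
move=> [phi' phiK phi'K].
(* The inverse of [F], with an irrelevant value 1 outside [H']. *)
have [Fi FiP] : exists Fi, forall y, H' y -> H (Fi y) /\ F (Fi y) = y.
  suff /choice[Fi FiP] : forall y, exists x, H' y -> H x /\ F x = y by exists Fi.
  move=> y; have [Hy|nHy] := pselect (H' y); last by exists 1%g.
  by have [x Hx ex] := Fsurj y Hy; exists x.
have FiF x : H x -> Fi (F x) = x.
  move=> Hx; have H'x := FH x Hx; have [h1 h2] := FiP _ H'x.
  by apply: Finj => //; exact: mem_set.
have FiM x y : H' x -> H' y -> Fi (x * y)%g = (Fi x * Fi y)%g.
  move=> hx hy; have [h1 e1] := FiP _ hx; have [h2 e2] := FiP _ hy.
  by rewrite -{1}e1 -{1}e2 -FM // FiF //; exact: subgroupM.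
have cH := finite_index_colorable sH fH.
(* Finite generation passes from [G] to [H], through [F] to [H'], and up to [G']. *)
have [s' gs'] : finitely_generated G'.
  have [s gs] := fg; have [t tH gt] := subgroup_generators R sH cH gs.
  apply: (finite_index_generates (finite_index_colorable sH' fH')) => y /FiP[Hy <-].
  exact: (morphism_on_generated sH FM tH (gt _ Hy)).
have [K' [sK' cK' K'H' phiK' phi'K']] := invariant_subgroup gs' sH' fH' phiK phi'K.
have FFi y : K' y -> F (Fi y) = y by move=> /K'H' /FiP[].
pose K : set G := [set x | H x /\ K' (F x)].
have FiK y : K' y -> K (Fi y).
  by move=> Ky; have [h1 h2] := FiP _ (K'H' _ Ky); split=> //; rewrite h2.
(* [phi] and its inverse, transported from [K'] to its copy [K] in [G]. *)
pose f := Fi \o phi \o F; pose f' := Fi \o phi' \o F.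
have fK x : K x -> K (f x) by move=> [_ /phiK']; exact: FiK.
have f'K x : K x -> K (f' x) by move=> [_ /phi'K']; exact: FiK.
have ff' x : K x -> f (f' x) = x.
  by move=> [Hx Kx]; rewrite /f /= FFi ?phi'K ?FiF //; exact: phi'K'.
have f'f x : K x -> f' (f x) = x.
  by move=> [Hx Kx]; rewrite /f' /= FFi ?phiK ?FiF //; exact: phiK'.
have fM x y : K x -> K y -> f (x * y)%g = (f x * f y)%g.
  by move=> [Hx Kx] [Hy Ky]; rewrite /f /= FM // gmulfM FiM //; apply/K'H'/phiK'.
have sK : is_subgroup K := preimage_subgroup sH FM sK'.
have cK : colorable K := preimage_colorable sH FM cH cK'.
have [w [[k [Hk K'k] wk] wf]] :=
  exists_fixed_character fg hb hS sK cK fK f'K ff' f'f fM.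
apply: (@infinite_twisted_classes R G' K' phi (w \o Fi)) => //.
- by move=> x y Kx Ky /=; rewrite FiM ?characterP //; exact: K'H'.
- by move=> x Kx /=; rewrite -[in RHS]wf; [rewrite /f /= FFi|exact: FiK].
- by exists (F k) => //=; rewrite FiF.
Qed.
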